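(* Let $\mathcal{C}$ be the class of all bivariate copulas and let $\mathcal{C}_{\mathrm{RS}}\subseteq\mathcal{C}$ be the subclass of radially symmetric copulas. Then $$\{(\xi(C),\beta(C)):C\in\mathcal{C}_{\mathrm{RS}}\}=\{(\xi(C),\beta(C)):C\in\mathcal{C}\}=\{(x,y)\in[0,1]\times[-1,1]:|y|^3\le 2x\}.$$
   Context: A bivariate copula is a function $C\colon[0,1]^2\to[0,1]$ with $C(u,0)=C(0,v)=0$, $C(u,1)=u$, $C(1,v)=v$ for all $u,v\in[0,1]$, and $C(v_1,v_2)-C(u_1,v_2)-C(v_1,u_2)+C(u_1,u_2)\ge 0$ whenever $u_1\le v_1$, $u_2\le v_2$. For a copula $C$, Chatterjee's rank correlation is $\xi(C)=6\int_0^1\int_0^1(\partial_1C(u,v))^2\,\mathrm{d}u\,\mathrm{d}v-2$ (partial derivative in the first argument, understood a.e.), and Blomqvist's beta is $\beta(C)=4C(\tfrac12,\tfrac12)-1$. $C$ is radially symmetric if $C(u,v)=u+v-1+C(1-u,1-v)$ for all $u,v\in[0,1]$. *)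

(* Defs.v *)
From mathcomp Require Import all_boot all_order all_algebra.
From mathcomp Require Import all_classical all_reals all_analysis.
Set Implicit Arguments.
Unset Strict Implicit.
Unset Printing Implicit Defensive.
Import Order.TTheory GRing.Theory Num.Theory.
Import numFieldNormedType.Exports.
Local Open Scope classical_set_scope.
Local Open Scope ring_scope.

(* A copula is given by a function on R x R of which only the restriction to
   the unit square is constrained.  The values outside the square are
   irrelevant to [chatterjee_xi] and [blomqvist_beta]: for 0 < u < 1 the
   derivative at u only involves values at points near u. *)
Record is_copula (R : realType) (C : R -> R -> R) : Prop := IsCopula {
  copula_range : forall u v : R, u \in `[0, 1] -> v \in `[0, 1] ->
    C u v \in `[0, 1] ;
  copula_0r : forall u : R, u \in `[0, 1] -> C u 0 = 0 ;
  copula_0l : forall v : R, v \in `[0, 1] -> C 0 v = 0 ;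
  copula_1r : forall u : R, u \in `[0, 1] -> C u 1 = u ;
  copula_1l : forall v : R, v \in `[0, 1] -> C 1 v = v ;
  copula_2incr : forall u1 u2 v1 v2 : R,
    u1 \in `[0, 1] -> u2 \in `[0, 1] -> v1 \in `[0, 1] -> v2 \in `[0, 1] ->
    u1 <= v1 -> u2 <= v2 ->
    0 <= C v1 v2 - C u1 v2 - C v1 u2 + C u1 u2 }.

Definition radially_symmetric (R : realType) (C : R -> R -> R) : Prop :=
  forall u v : R, u \in `[0, 1] -> v \in `[0, 1] ->
    C u v = u + v - 1 + C (1 - u) (1 - v).

Definition copulas (R : realType) : set (R -> R -> R) :=
  [set C | is_copula C].
Arguments copulas : clear implicits.

Definition rs_copulas (R : realType) : set (R -> R -> R) :=
  [set C | is_copula C /\ radially_symmetric C].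
Arguments rs_copulas : clear implicits.

(* For a copula C and v in [0, 1], C(., v) is 1-Lipschitz on [0, 1], hence
   differentiable almost everywhere there; the default value of the derivative
   at the remaining points does not affect the integral. *)
Definition chatterjee_xi (R : realType) (C : R -> R -> R) : R :=
  6 * (\int[lebesgue_measure]_(v in `[0, 1])
        \int[lebesgue_measure]_(u in `[0, 1])
          (derive1 (C ^~ v) u) ^+ 2) - 2.

Definition blomqvist_beta (R : realType) (C : R -> R -> R) : R :=
  4 * C 2^-1 2^-1 - 1.

(* Main.v *)
Require Import Defs.
From HB Require Import structures.
From mathcomp Require Import all_boot all_order all_algebra.
From mathcomp Require Import all_classical all_reals all_analysis.
From mathcomp Require Import measurable_realfun ring lra.
Import Order.TTheory GRing.Theory Num.Theory.
Import numFieldNormedType.Exports.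
Local Open Scope classical_set_scope.
Local Open Scope ring_scope.

(**
Write b for the absolute value of beta(C), f_v = C(., v), and let
d(v) = 2 C(1/2, v) - v.

Bounds.  Each f_v is nondecreasing and 1-Lipschitz, so it is the integral of a
density h with values in [0, 1] ([density_exists]), and f_v' = h almost
everywhere ([integral_derive_sqr]).  From h^2 <= h one gets
int (f_v')^2 <= f_v(1) = v, hence xi(C) <= 6/2 - 2 = 1.  In the other direction
the means of h over the two halves of [0, 1] are v + d(v) and v - d(v), and
Jensen's inequality on each half gives
    int (f_v')^2 >= v^2 + d(v)^2                  ([density_sqr_lower]).
Since d is 1-Lipschitz with d(1/2) = beta(C)/2, it dominates in absolute value
the tent (b/2 - |v - 1/2|)_+ ([tent_le_gap]), whose square has integral
b^3/12.  Integrating in v, xi(C) >= 6 (1/3 + b^3/12) - 2 = b^3/2.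

Attainment.  Equality in the lower bound forces h to be constant on each half
and d to be the tent up to sign; this is the radially symmetric copula
[tent_copula], uv + sgn(beta) tent(v) min(u, 1 - u).  At the other end, a
measure-preserving involution T of [0, 1] with T(1 - s) = 1 - T(s) carries a
radially symmetric copula with xi = 1, because the slopes of its sections are 0
or 1; reversing the middle interval [p, 1 - p] with p = (1 + beta)/4 gives
[shuffle] with the prescribed beta.  Along the segment joining the two copulas
beta and radial symmetry are preserved and xi is a quadratic polynomial of the
parameter ([chatterjee_xi_mixture]), so the intermediate value theorem reaches
every xi between b^3/2 and 1.
*)

(** * Comparison of integrals of possibly nonmeasurable functions *)

Section LowerIntegral.
Context d (T : measurableType d) (R : realType).
Variable mu : {measure set T -> \bar R}.
Import HBNNSimple.
Local Open Scope ereal_scope.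

(** The integral of a nonnegative function is a supremum over the simple
functions below it, which is monotone for arbitrary functions.  For a general
copula, the map from v to the integral of (f_v')^2 is compared in this way with
explicit functions of v. *)
Lemma ge0_le_integral_nonmeas (D : set T) (f g : T -> \bar R) :
  (forall x, D x -> 0 <= f x) -> (forall x, D x -> f x <= g x) ->
  \int[mu]_(x in D) f x <= \int[mu]_(x in D) g x.
Proof.
move=> f0 fg.
have g0 x : D x -> 0 <= g x by move=> Dx; exact: le_trans (f0 x Dx) (fg x Dx).
rewrite !ge0_integralE//; apply: ereal_sup_le => _ [h /= hf <-].
exists h => //= x; apply: le_trans (hf x) _; rewrite !patchE.
by case: ifPn => // /set_mem /fg.
Qed.

(** Replacing g on N by +oo, respectively by 0, yields measurable functions
above and below f with the same integral as g.  The default value of a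
derivative at points of nondifferentiability is absorbed this way. *)
Lemma integral_null_modification (D N : set T) (f g : T -> \bar R) :
  measurable D -> measurable N -> mu N = 0 -> measurable_fun D g ->
  (forall x, D x -> 0 <= f x) -> (forall x, D x -> 0 <= g x) ->
  (forall x, D x -> ~ N x -> f x = g x) ->
  \int[mu]_(x in D) f x = \int[mu]_(x in D) g x.
Proof.
move=> mD mN N0 mg f0 g0 fg.
have mc (c : \bar R) : measurable_fun D (fun x => if x \in N then c else g x).
  apply: measurable_fun_if => //.
  - apply: (@measurable_fun_bool _ _ _ _ true).
    rewrite [X in measurable X](_ : _ = D `&` N); first exact: measurableI.
    by apply/seteqP; split => x [Dx /=]; [move/set_mem|move/mem_set->].
  - exact: measurable_funS mg.
have eqc (c : \bar R) : 0 <= c ->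
    \int[mu]_(x in D) (if x \in N then c else g x) = \int[mu]_(x in D) g x.
  move=> c0; apply: ge0_ae_eq_integral => //.
    by move=> x Dx; case: ifP => // _; exact: g0.
  exists N; split => // x /= /not_implyP[Dx].
  by case: ifPn => [/set_mem//|].
apply/eqP; rewrite eq_le; apply/andP; split.
  rewrite -[leRHS](eqc +oo)//; apply: ge0_le_integral_nonmeas => // x Dx.
  by case: ifPn => [_|]; [exact: leey|rewrite notin_setE => /(fg x Dx) ->].
rewrite -[leLHS](eqc 0)//; apply: ge0_le_integral_nonmeas => x Dx.
  by case: ifP => // _; exact: g0.
by case: ifPn => [_|]; [exact: f0|rewrite notin_setE => /(fg x Dx) ->].
Qed.

Lemma le_Rintegral_nonmeas (D : set T) (f g : T -> R) :
  \int[mu]_(x in D) (g x)%:E < +oo ->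
  (forall x, D x -> 0 <= f x)%R -> (forall x, D x -> f x <= g x)%R ->
  (\int[mu]_(x in D) f x <= \int[mu]_(x in D) g x)%R.
Proof.
move=> goo f0 fg.
have le : \int[mu]_(x in D) (f x)%:E <= \int[mu]_(x in D) (g x)%:E.
  by apply: ge0_le_integral_nonmeas => x Dx; rewrite lee_fin; [exact: f0|exact: fg].
have I0 : 0 <= \int[mu]_(x in D) (f x)%:E.
  by apply: integral_ge0 => x Dx; rewrite lee_fin f0.
apply: fine_le => //; rewrite ge0_fin_numE//; first exact: le_lt_trans goo.
exact: le_trans le.
Qed.

End LowerIntegral.

(** * Densities of Lipschitz functions on the unit interval *)

Section Density.
Context (R : realType).
Local Notation mu := (@lebesgue_measure R).
Implicit Types f h : R -> R.

Lemma bounded_integrable (h : R -> R) (M a b : R) :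
  measurable_fun setT h -> (forall x, x \in `[a, b] -> `|h x| <= M) ->
  mu.-integrable `[a, b] (EFin \o h).
Proof.
move=> mh hM; apply: measurable_bounded_integrable => //=.
- exact: (compact_finite_measure (@segment_compact R a b)).
- exact: measurable_funTS mh.
- exists M; split; first exact: num_real.
  by move=> y My x xab; exact: le_trans (hM x xab) (ltW My).
Qed.

Let measure0_U (A B : set R) : measurable A -> measurable B ->
  mu A = 0%E -> mu B = 0%E -> mu (A `|` B) = 0%E.
Proof.
move=> mA mB A0 B0; apply/eqP; rewrite eq_le measure_ge0 andbT.
rewrite -[leRHS]adde0 -[X in (_ <= X + _)%E]A0 -[X in (_ <= _ + X)%E]B0.
exact: measureU2.
Qed.

(** The bounds hold everywhere rather than almost everywhere, so that h is
integrable on every segment and h^2 <= h pointwise. *)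
Definition is_density (f h : R -> R) : Prop :=
  [/\ measurable_fun setT h, forall u, 0 <= h u <= 1 &
      forall x, x \in `[0, 1] -> f x = \int[mu]_(u in `[0, x]) h u].

(** Lebesgue differentiation.  The endpoints are excluded because f agrees with
the primitive only on [0, 1], while its derivative at an endpoint also sees
values outside. *)
Lemma ae_derive_primitive (f h : R -> R) :
  (forall y, mu.-integrable `[0, y] (EFin \o h)) ->
  locally_integrable setT h ->
  (forall x, x \in `[0, 1] -> f x = \int[mu]_(u in `[0, x]) h u) ->
  \forall x \ae mu, x \in `]0, 1[ -> derivable f x 1 /\ derive1 f x = h x.
Proof.
move=> ih lh fE.
have := @FTC1 R h (BLeft 0) ih lh; apply: filterS.
  exact: (ae_filter_ringOfSetsType mu).
move=> x + x01.
set F := fun x => _ : R.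
case; first by rewrite lte_fin (itvP x01).
move=> dF F'.
have Ff : {near x, F =1 f}.
  have := near_in_itvoo x01; apply: filterS => y y01; rewrite fE//.
  by apply: subset_itv_oo_cc.
split; first exact: near_eq_derivable Ff dF.
by rewrite -F' !derive1E; apply/esym/near_eq_derive.
Qed.

Lemma density_integrable f h a b : is_density f h ->
  mu.-integrable `[a, b] (EFin \o h).
Proof.
move=> [mh h01 _]; apply: (@bounded_integrable _ 1) => // x _.
by have /andP[h0 h1] := h01 x; rewrite ger0_norm.
Qed.

Lemma density_locally_integrable f h : is_density f h ->
  locally_integrable setT h.
Proof.
move=> [mh h01 _]; split => //; first exact: openT.
move=> K _ cK; have Koo := compact_finite_measure cK.
have mK : measurable K by exact: compact_measurable.
apply: le_lt_trans (_ : \int[mu]_(x in K) (cst 1%:E x) < +oo)%E; last first.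
  by rewrite integral_cst// mul1e.
apply: ge0_le_integral_nonmeas => x Kx; rewrite lee_fin//.
by have /andP[h0 h1] := h01 x; rewrite ger0_norm.
Qed.

Lemma integral_derive_sqr f h : is_density f h ->
  \int[mu]_(u in `[0, 1]) (derive1 f u) ^+ 2 =
  \int[mu]_(u in `[0, 1]) (h u) ^+ 2.
Proof.
move=> fh; have [mh h01 fE] := fh.
have [N [mN N0 sN]] := ae_derive_primitive f h
  (fun y => density_integrable f h 0 y fh)
  (density_locally_integrable f h fh) fE.
have m01 : measurable [set (0 : R); 1] by apply: measurableU; exact: measurable_set1.
have mu01 : mu [set (0 : R); 1] = 0%E.
  by apply: measure0_U; rewrite ?lebesgue_measure_set1//; exact: measurable_set1.
congr fine; apply: (@integral_null_modification _ _ _ mu _ (N `|` [set 0; 1])) => //.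
- exact: measurableU.
- exact: measure0_U.
- by apply/measurable_EFinP; apply: measurable_funTS; exact: measurable_funX.
- by move=> x _; rewrite lee_fin sqr_ge0.
- by move=> x _; rewrite lee_fin sqr_ge0.
- move=> x /= x01 /not_orP[Nx /not_orP[/eqP x0 /eqP x1]].
  have xoo : x \in `]0, 1[.
    by move: x01; rewrite !in_itv/= !lt_neqAle eq_sym x0 x1.
  suff [_ ->] : derivable f x 1 /\ derive1 f x = h x by [].
  by apply: contrapT => nx; apply: Nx; apply: sN => /= /(_ xoo).
Qed.

End Density.

Section DensityExists.
Context (R : realType).
Local Notation mu := (@lebesgue_measure R).

Lemma stieltjes_itv (F : cumulative R R) (a b : R) : a <= b ->
  lebesgue_stieltjes_measure F `]a, b]%classic = (F b - F a)%:E.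
Proof.
move=> ab; rewrite /lebesgue_stieltjes_measure /measure_extension/=.
by rewrite measurable_mu_extE/=; [rewrite wlength_itv_bnd|exact: is_ocitv].
Qed.

(** The Stieltjes measures of F and of G = id - F add up to Lebesgue measure,
as they do so on half-open intervals. *)
Lemma stieltjes_le_lebesgue (F G : cumulative R R) :
  (forall x, F x + G x = x) -> forall A : set R, measurable A ->
  (lebesgue_stieltjes_measure F A <= mu A)%E.
Proof.
move=> FG A mA.
pose nu := measure_add (lebesgue_stieltjes_measure F) (lebesgue_stieltjes_measure G).
have nuE B : nu B = (lebesgue_stieltjes_measure F B + lebesgue_stieltjes_measure G B)%E.
  exact: measure_addE.
have -> : mu A = nu A.
  apply: lebesgue_measure_unique => //= _ [[a b] _ <-] /=.
  rewrite [RHS]nuE; have [ab|ba] := leP a b; last first.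
    by rewrite set_itv_ge ?measure0 ?adde0// bnd_simp -leNgt ltW.
  rewrite [LHS](stieltjes_itv idfun)// !stieltjes_itv// -EFinD; congr EFin; rewrite /=.
  by have := FG a; have := FG b; lra.
by rewrite [leRHS]nuE leeDl.
Qed.

Lemma nondecreasing_lipschitz_cumulative (F : R -> R) :
  (forall x y, x <= y -> 0 <= F y - F x <= y - x) ->
  exists Fc : cumulative R R, (Fc : R -> R) = F.
Proof.
move=> FL.
have ndF : nondecreasing F by move=> x y /FL /andP[]; rewrite subr_ge0.
have rcF : right_continuous F.
  apply: right_continuousW => x; apply/cvgrPdist_lt => e e0; near=> y.
  have xy : `|x - y| < e by near: y; exact: cvgr_dist_lt.
  apply: le_lt_trans xy; have [yx|/ltW yx] := leP y x.
    have /andP[h1 h2] := FL _ _ yx.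
    by rewrite !ger0_norm// subr_ge0.
  have /andP[h1 h2] := FL _ _ yx.
  by rewrite distrC (distrC x) !ger0_norm// subr_ge0.
pose mF := isCumulative.Build R _ R F ndF rcF.
pose Fc : cumulative R R := HB.pack F mF.
by exists Fc.
Unshelve. all: by end_near. Qed.

(** The Stieltjes measure of F is dominated by Lebesgue measure, hence absolutely
continuous; its Radon-Nikodym derivative is the required h. *)
Lemma radon_nikodym_primitive (F : R -> R) :
  (forall x y, x <= y -> 0 <= F y - F x <= y - x) ->
  exists h : R -> R, mu.-integrable setT (EFin \o h) /\
   forall x, 0 <= x <= 1 -> F x - F 0 = \int[mu]_(u in `[0, x]) h u.
Proof.
move=> FL.
have [Fc FcE] := nondecreasing_lipschitz_cumulative F FL.
have [|Gc GcE] := nondecreasing_lipschitz_cumulative (fun x => x - F x).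
  by move=> x y /[dup] xy /FL /andP[h1 h2]; apply/andP; split; lra.
have nuF := stieltjes_le_lebesgue Fc Gc.
have {}nuF : forall A : set R, measurable A ->
    (lebesgue_stieltjes_measure Fc A <= mu A)%E.
  by apply: nuF => x; rewrite FcE GcE; lra.
have mD : measurable (`]0, 1]%classic : set (measurableTypeR R)) by exact: measurable_itv.
have nuoo : (lebesgue_stieltjes_measure Fc `]0%R, 1%R]%classic < +oo)%E.
  by rewrite stieltjes_itv// ltry.
(* Radon-Nikodym asks for a finite measure, hence the restriction to ]0, 1]. *)
pose nu : {finite_measure set _ -> \bar R} := mfrestr mD nuoo.
have nu_mu : nu `<< mu.
  apply/null_content_dominatesP => A mA A0; apply/eqP.
  rewrite eq_le measure_ge0 andbT -A0 /nu/= /mfrestr /mrestr.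
  apply: le_trans (nuF _ _) _; first exact: measurableI.
  by apply: le_measure; rewrite ?inE//; exact: measurableI.
have [g [g0 gfin gint gE]] := radon_nikodym_sigma_finite nu_mu.
have gfine : EFin \o (fine \o g) = g by apply/funext => x /=; rewrite fineK.
exists (fine \o g); rewrite gfine; split=> // x /andP[x0 x1].
have int0x : mu.-integrable `]0, x] (EFin \o (fine \o g)).
  by rewrite gfine; apply: integrableS gint.
rewrite -Rintegral_itv_obnd_cbnd// /Rintegral.
rewrite -[X in integral _ _ X]/(EFin \o (fine \o g)) gfine.
have := gE `]0, x]%classic; rewrite -gE//= /nu/= /mfrestr /mrestr.
rewrite setIidl; last by apply: subset_itvl; rewrite bnd_simp.
by rewrite stieltjes_itv// FcE.
Qed.

Lemma derive1_lipschitz (f : R -> R) (x : R) :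
  (forall x y, 0 <= x -> x <= y -> y <= 1 -> 0 <= f y - f x <= y - x) ->
  x \in `]0, 1[ -> derivable f x 1 -> 0 <= derive1 f x <= 1.
Proof.
move=> fL x01 df.
have quot : \forall r \near 0^', 0 <= r^-1 * (f (r + x) - f x) <= 1.
  move: x01; rewrite in_itv/= => /andP[x0 x1].
  near=> r.
  have r0 : r != 0 by near: r; exact: nbhs_dnbhs_neq.
  have rx : `|r| < x by near: r; exact: dnbhs0_lt.
  have rx1 : `|r| < 1 - x by near: r; apply: dnbhs0_lt; rewrite subr_gt0.
  move: rx rx1; rewrite !ltr_norml => /andP[rx0 _] /andP[_ rx1].
  rewrite mulrC; have [rn|rp|r00] := ltgtP r 0.
  - have /andP[h1 h2] : 0 <= f x - f (r + x) <= x - (r + x) by apply: fL; lra.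
    rewrite ler_ndivlMr// ler_ndivrMr//; apply/andP; split; lra.
  - have /andP[h1 h2] : 0 <= f (r + x) - f x <= (r + x) - x by apply: fL; lra.
    rewrite ler_pdivlMr// ler_pdivrMr//; apply/andP; split; lra.
  - by rewrite r00 eqxx in r0.
have cv : cvg (r^-1 *: (f (r + x) - f x) @[r --> 0^']).
  move: df; rewrite /derivable.
  set F := (F in cvg (F r @[r --> _]) -> _); set G := (G in _ -> cvg (G r @[r --> _])).
  suff -> : F = G by [].
  by apply/funext => r; rewrite /F /G /= [X in f (X + _)]mulr1.
rewrite /derive1; apply/andP; split.
  by apply: limr_ge => //; apply: filterS quot => r /andP[].
by apply: limr_le => //; apply: filterS quot => r /andP[].
Unshelve. all: by end_near. Qed.

(** f is extended to the line by clamping its argument, so that its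
Radon-Nikodym derivative exists; that derivative equals f' almost everywhere,
hence lies in [0, 1] there, and clamping it changes it on a null set only. *)
Lemma density_exists (f : R -> R) : f 0 = 0 ->
  (forall x y, 0 <= x -> x <= y -> y <= 1 -> 0 <= f y - f x <= y - x) ->
  exists h, is_density R f h.
Proof.
move=> f0 fL.
pose c (x : R) := Num.max 0 (Num.min x 1).
have cid x : 0 <= x <= 1 -> c x = x.
  by move=> /andP[x0 x1]; rewrite /c min_l// max_r.
have c01 x : 0 <= c x <= 1.
  by rewrite /c le_max lexx/= ge_max ler01/= ge_min lexx orbT.
have cL x y : x <= y -> 0 <= c y - c x <= y - x.
  move=> xy; rewrite /c.
  case: (leP x 1) => ?; case: (leP y 1) => ?; case: (leP 0 x) => ?;
    case: (leP 0 y) => ?; case: (leP 0 (1 : R)) => ?; apply/andP; split; lra.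
have [|g [gint gE]] := radon_nikodym_primitive (f \o c).
  move=> x y /cL /andP[c1 c2] /=.
  have /andP[x0 x1] := c01 x; have /andP[y0 y1] := c01 y.
  have /andP[] : 0 <= f (c y) - f (c x) <= c y - c x.
    by apply: fL => //; rewrite -subr_ge0.
  by move=> h1 h2; rewrite h1 (le_trans h2).
have fE x : x \in `[0, 1] -> f x = \int[mu]_(u in `[0, x]) g u.
  rewrite in_itv/= => x01; rewrite -gE//= !cid ?f0 ?subr0//.
  by rewrite lexx ler01.
have gint' y : mu.-integrable `[0, y] (EFin \o g) by apply: integrableS gint.
have gloc : locally_integrable setT g.
  by apply: open_integrable_locally => //; exact: openT.
have mg : measurable_fun setT g by case: gloc.
have ae := ae_derive_primitive R f g gint' gloc fE.
pose h x := Num.max 0 (Num.min (g x) 1).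
have mh : measurable_fun setT h.
  by apply: measurable_maxr => //; apply: measurable_minr.
have gh : \forall x \ae mu, x \in `]0, 1[ -> g x = h x.
  move: ae; apply: filterS; first exact: (ae_filter_ringOfSetsType mu).
  move=> x /[swap] /[dup] x01 -> [//|df e]; rewrite /h -e.
  have /andP[d0 d1] := derive1_lipschitz f x fL x01 df.
  by rewrite min_l// max_r.
exists h; split => // [u|x x01].
  by rewrite /h le_max lexx/= ge_max ler01/= ge_min lexx orbT.
rewrite fE//.
have h1 u : `|h u| <= 1.
  by rewrite ger0_norm /h; [rewrite ge_max ler01/= ge_min lexx orbT|rewrite le_max lexx].
have inth : mu.-integrable `[0, x] (EFin \o h).
  by apply: (@bounded_integrable R _ 1).
have open_itv (k : R -> R) : mu.-integrable `[0, x] (EFin \o k) ->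
    \int[mu]_(u in `[0, x]) k u = \int[mu]_(u in `]0, x[) k u.
  move=> ik; rewrite -Rintegral_itv_obnd_cbnd; last first.
    by apply: integrableS ik => //; exact: subset_itv_oc_cc.
  rewrite -Rintegral_itv_bndo_bndc//.
  by apply: integrableS ik => //; exact: subset_itv_oo_cc.
rewrite !open_itv//; congr fine; apply: ae_eq_integral => //.
- by apply/measurable_EFinP; exact: measurable_funTS.
- by apply/measurable_EFinP; exact: measurable_funTS.
move: gh; apply: filterS; first exact: (ae_filter_ringOfSetsType mu).
move=> u gh /= u0x; congr EFin; apply: gh.
by move: x01 u0x; rewrite !in_itv/= => /andP[_ x1] /andP[-> /lt_le_trans]; exact.
Qed.

End DensityExists.

(** * Bounds on the integral of the square of a density *)

Section Bounds.
Context (R : realType).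
Local Notation mu := (@lebesgue_measure R).
Local Notation is_density := (is_density R).

Lemma Rintegral_indic_itvoc (b c x : R) : 0 <= b ->
  \int[mu]_(u in `[0, x]) \1_(`]b, c]%classic : set R) u =
  Num.max 0 (Num.min x c - b).
Proof.
move=> b0; rewrite /Rintegral integral_indic//.
have -> : `]b, c]%classic `&` `[0, x]%classic = `]b, Num.min x c]%classic :> set R.
  apply/seteqP; split => u /=; rewrite !in_itv/= le_min.
    by move=> [/andP[-> ->] /andP[_ ->]].
  by move=> /andP[bu /andP[-> ->]]; rewrite bu (le_trans b0 (ltW bu)).
rewrite /= lebesgue_measure_itv/= lte_fin; case: ifPn => [bx|].
  by rewrite -EFinD/= max_r// subr_ge0 ltW.
by rewrite -leNgt => xb; rewrite max_l// subr_le0.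
Qed.

Lemma indic01 (A : set R) (x : R) : 0 <= (\1_A x : R) <= 1.
Proof. by rewrite indicE; case: (_ \in _); rewrite ?lexx ?ler01. Qed.

Lemma cst1_density : is_density id (cst 1).
Proof.
split => // [x|x]; first by rewrite ler01 lexx.
rewrite in_itv/= => /andP[x0 _].
rewrite Rintegral_cst//= lebesgue_measure_itv/= lte_fin mul1r.
case: ifPn => [|]; first by rewrite sube0.
by rewrite -leNgt => ?; apply/eqP; rewrite eq_le x0 andbT.
Qed.

Lemma density_sqr_integrable f h : is_density f h ->
  mu.-integrable `[0, 1] (EFin \o (fun u => h u ^+ 2)).
Proof.
move=> [mh h01 _]; apply: (@bounded_integrable R _ 1); first exact: measurable_funX.
move=> u _; have /andP[h0 h1] := h01 u.
by rewrite ger0_norm ?sqr_ge0// expr_le1.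
Qed.

Local Notation half := (\1_(`]0, 2^-1]%classic : set R)).

Lemma step_density_integrable f h (a b : R) (k : R -> R) : is_density f h ->
  (forall u, k u = (a + b * half u) * h u) ->
  mu.-integrable `[0, 1] (EFin \o k).
Proof.
move=> [mh h01 _] /funext ->; apply: (@bounded_integrable R _ (`|a| + `|b|)).
  apply: measurable_funM => //; apply: measurable_funD => //.
  by apply: measurable_funM => //; exact: measurable_indic.
move=> u _; have /andP[h0 h1] := h01 u; have /andP[i0 i1] := indic01 `]0, 2^-1]%classic u.
rewrite normrM (ger0_norm h0); apply: le_trans (_ : `|a + b * half u| <= _).
  by rewrite ler_piMr.
apply: le_trans (ler_normD _ _) _; rewrite lerD2l normrM (ger0_norm i0).
by rewrite ler_piMr.
Qed.

(** Pairing a density with a step function that jumps at 1/2 only involves the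
values of f at 1/2 and 1.  Applied to h = 1 (the density of the identity) it
integrates the step functions themselves. *)
Lemma Rintegral_step_density f h (a b : R) : is_density f h ->
  \int[mu]_(u in `[0, 1]) ((a + b * half u) * h u) = a * f 1 + b * f 2^-1.
Proof.
move=> fh; have [mh h01 fE] := fh.
have ih := density_integrable R f h 0 1 fh.
have iih : mu.-integrable `[0, 1] (EFin \o (fun u => half u * h u)).
  by apply: (step_density_integrable f h 0 1) => // u; ring.
under eq_Rintegral do rewrite mulrDl -mulrA.
rewrite RintegralD//; last 2 first.
- by apply: (step_density_integrable f h a 0) => // u; ring.
- by apply: (step_density_integrable f h 0 b) => // u; ring.
rewrite !RintegralZl// (fE 1) ?in_itv/= ?ler01 ?lexx//; congr (_ + _ * _).
have half01 : 2^-1 \in `[0, 1 :> R] by rewrite in_itv/=; lra.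
rewrite (fE _ half01) -[RHS]Rintegral_itv_obnd_cbnd; last first.
  have i2 := density_integrable R f h 0 2^-1 fh.
  by apply: integrableS i2 => //; exact: subset_itv_oc_cc.
have sub : `[0, 1]%classic `&` `]0, 2^-1]%classic = `]0, 2^-1]%classic :> set R.
  by apply/setIidr => u /=; rewrite !in_itv/= => /andP[u0 u1]; lra.
rewrite -[X in _ = Rintegral _ X _]sub Rintegral_mkcondr; apply: eq_Rintegral => u _.
by rewrite patchE indicE; case: ifP => _; rewrite ?mul1r ?mul0r.
Qed.

Lemma density_sqr_upper f h : is_density f h ->
  \int[mu]_(u in `[0, 1]) h u ^+ 2 <= f 1.
Proof.
move=> fh; have [mh h01 fE] := fh.
rewrite fE ?in_itv/= ?ler01 ?lexx//; apply: le_Rintegral => //.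
- exact: density_sqr_integrable fh.
- exact: density_integrable fh.
- by move=> u _; have /andP[h0 h1] := h01 u; rewrite expr2 ler_piMr.
Qed.

(** Jensen on the two halves of [0, 1]: s is the step function of the means of h
over the halves, and h^2 >= 2 s h - s^2. *)
Lemma density_sqr_lower f h : is_density f h ->
  f 1 ^+ 2 + (2 * f 2^-1 - f 1) ^+ 2 <= \int[mu]_(u in `[0, 1]) h u ^+ 2.
Proof.
move=> fh; have [mh h01 fE] := fh.
set v := f 1; set d := 2 * f 2^-1 - v.
pose s u := (v - d) + 2 * d * half u.
have s2 u : s u ^+ 2 = ((v - d) ^+ 2 + 4 * v * d * half u) * cst 1 u.
  by rewrite /s indicE; case: (_ \in _); rewrite /=; ring.
have ish : mu.-integrable `[0, 1] (EFin \o (fun u => 2 * (s u * h u))).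
  apply: (step_density_integrable f h (2 * (v - d)) (2 * (2 * d))) => // u.
  by rewrite /s; ring.
have is2 : mu.-integrable `[0, 1] (EFin \o (fun u => s u ^+ 2)).
  exact: step_density_integrable cst1_density s2.
have : \int[mu]_(u in `[0, 1]) (2 * (s u * h u) - s u ^+ 2) <=
    \int[mu]_(u in `[0, 1]) h u ^+ 2.
  apply: le_Rintegral => //.
  - exact: (integrableB _ ish is2).
  - exact: density_sqr_integrable fh.
  - by move=> u _; rewrite -subr_ge0 (_ : _ - _ = (h u - s u) ^+ 2) ?sqr_ge0//; ring.
apply: le_trans; rewrite RintegralB//.
under [X in _ - X]eq_Rintegral do rewrite s2.
rewrite (Rintegral_step_density _ _ _ _ cst1_density).
under eq_Rintegral do rewrite mulrA mulrDr mulrA.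
rewrite (Rintegral_step_density f h)// -/v.
have -> : f 2^-1 = (v + d) / 2 by rewrite /d; field.
by rewrite le_eqVlt; apply/orP; left; apply/eqP; field.
Qed.

End Bounds.

(** * The tent function *)

Section Outer.
Context (R : realType).
Local Notation mu := (@lebesgue_measure R).

Lemma Rintegral_sqr_shift (a b c : R) : a <= b ->
  \int[mu]_(x in `[a, b]) (x - c) ^+ 2 = ((b - c) ^+ 3 - (a - c) ^+ 3) / 3.
Proof.
rewrite le_eqVlt => /predU1P[->|ab].
  by rewrite set_itv1 Rintegral_set1 subrr mul0r.
pose F (x : R) := 3^-1 * (x - c) ^+ 3.
have dF (x : R) : is_derive x 1 F ((x - c) ^+ 2).
  apply: is_derive_eq.
  by rewrite /GRing.scale/=; field.
have cF : continuous F.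
  by move=> x; apply/differentiable_continuous/derivable1_diffP; case: (dF x).
have cf : continuous (fun x : R => (x - c) ^+ 2).
  move=> x; rewrite /continuous_at; under eq_fun do rewrite expr2.
  by rewrite expr2; apply: cvgM; apply: cvgB; try exact: cvg_id; exact: cvg_cst.
rewrite /Rintegral (@continuous_FTC2 R (fun x => (x - c) ^+ 2) F a b) //=.
- by rewrite /F; field.
- exact: continuous_subspaceT.
- split; first by move=> x _; case: (dF x).
    exact: cvg_at_right_filter (cF a).
  exact: cvg_at_left_filter (cF b).
- by move=> x _; rewrite derive1E derive_val.
Qed.

Lemma Rintegral_itv_split (a b c : R) (f : R -> R) : a <= b -> b <= c ->
  mu.-integrable `[a, c] (EFin \o f) ->
  \int[mu]_(x in `[a, c]) f x =
  \int[mu]_(x in `[a, b]) f x + \int[mu]_(x in `[b, c]) f x.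
Proof.
move=> ab bc intf.
have intbc : mu.-integrable `]b, c] (EFin \o f).
  by apply: integrableS intf => //; apply: subset_itvr; rewrite bnd_simp.
rewrite -[X in _ = _ + X]Rintegral_itv_obnd_cbnd//.
by rewrite -(@Rintegral_itvB R f _ _ b intf) ?bnd_simp// addrC subrK.
Qed.

Lemma id_sqr_integrable : mu.-integrable `[0, 1] (EFin \o (fun v : R => v ^+ 2)).
Proof.
apply: (@bounded_integrable R _ 1); first exact: measurable_funX.
move=> v; rewrite in_itv/= => /andP[v0 v1].
by rewrite ger0_norm ?sqr_ge0// expr_le1.
Qed.

Lemma id_integrable : mu.-integrable `[0, 1] (EFin \o (fun v : R => v)).
Proof.
apply: (@bounded_integrable R _ 1) => // v; rewrite in_itv/= => /andP[v0 v1].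
by rewrite ger0_norm.
Qed.

Lemma Rintegral_id_sqr : \int[mu]_(v in `[0, 1]) (v ^+ 2) = 3^-1.
Proof.
have := Rintegral_sqr_shift 0 1 0 ler01.
under eq_Rintegral do rewrite subr0.
by move=> ->; field.
Qed.

Lemma Rintegral_id : \int[mu]_(v in `[0, 1]) v = 2^-1.
Proof.
(* The integral of v is read off from those of (v - 1/2)^2 and v^2. *)
have := Rintegral_sqr_shift 0 1 2^-1 ler01.
have -> : \int[mu]_(v in `[0, 1]) ((v - 2^-1) ^+ 2) =
    \int[mu]_(v in `[0, 1]) ((v ^+ 2 + 4^-1 * cst 1 v) - v).
  by apply: eq_Rintegral => v _; rewrite /=; field.
have i1 := density_integrable R id (cst 1) 0 1 (cst1_density R).
have ic : mu.-integrable `[0, 1] (EFin \o (fun v : R => 4^-1 * cst 1 v)).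
  apply: (@bounded_integrable R _ 1); first exact: measurable_funM.
  by move=> v _; rewrite /= ger0_norm; lra.
rewrite RintegralB//; last 2 first.
- exact: (integrableD _ id_sqr_integrable ic).
- exact: id_integrable.
rewrite RintegralD//; last exact: id_sqr_integrable.
rewrite RintegralZl// Rintegral_id_sqr.
have [_ _ /(_ 1) <-] := cst1_density R; last by rewrite in_itv/= ler01 lexx.
rewrite [RHS](_ : _ = 12^-1); last by field.
by move=> E; lra.
Qed.

(** The least nonnegative 1-Lipschitz function with value b/2 at 1/2. *)
Definition tent (b v : R) : R := Num.max 0 (b / 2 - `|v - 2^-1|).

Lemma measurable_tent b : measurable_fun setT (tent b).
Proof.
apply: measurable_maxr => //; apply: measurable_funB => //.
by apply: measurableT_comp => //; exact: measurable_funB.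
Qed.

Lemma tent_bounds b v : 0 <= b <= 1 -> 0 <= tent b v <= 2^-1.
Proof.
move=> /andP[b0 b1]; rewrite /tent le_max lexx/= ge_max.
by have := normr_ge0 (v - 2^-1); lra.
Qed.

Lemma tent_sqr_integrable b : 0 <= b <= 1 ->
  mu.-integrable `[0, 1] (EFin \o (fun v => tent b v ^+ 2)).
Proof.
move=> b01; apply: (@bounded_integrable R _ 1).
  by apply: measurable_funX; exact: measurable_tent.
move=> v _; have /andP[t0 t1] := tent_bounds b v b01.
by rewrite ger0_norm ?sqr_ge0// expr_le1//; lra.
Qed.

Lemma Rintegral_tent_sqr b : 0 <= b <= 1 ->
  \int[mu]_(v in `[0, 1]) (tent b v ^+ 2) = b ^+ 3 / 12.
Proof.
move=> b01; have it := tent_sqr_integrable b b01.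
have sub (x y : R) : 0 <= x -> y <= 1 ->
    mu.-integrable `[x, y] (EFin \o (fun v => tent b v ^+ 2)).
  move=> x0 y1; apply: integrableS it => //.
  by apply: subset_itv; rewrite bnd_simp.
case/andP: b01 => b0 b1.
(* [a, e] is the support of the tent. *)
pose a := (1 - b) / 2; pose e := (1 + b) / 2.
have a0 : 0 <= a by rewrite /a; lra.
have ah : a <= 2^-1 by rewrite /a; lra.
have he : 2^-1 <= e by rewrite /e; lra.
have e1 : e <= 1 by rewrite /e; lra.
have a1 : a <= 1 by rewrite /a; lra.
have h1 : 2^-1 <= 1 :> R by lra.
have h0 : 0 <= 2^-1 :> R by lra.
rewrite (Rintegral_itv_split 0 a 1 _ a0 a1 it).
rewrite (Rintegral_itv_split a 2^-1 1 _ ah h1 (sub _ _ a0 (lexx 1))).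
rewrite (Rintegral_itv_split 2^-1 e 1 _ he e1 (sub _ _ h0 (lexx 1))).
have -> : \int[mu]_(v in `[0, a]) (tent b v ^+ 2) = 0.
  rewrite (@eq_Rintegral _ _ _ mu `[0, a]%classic (cst 0)) ?Rintegral_cst ?mul0r//.
  move=> v; rewrite inE/= in_itv/= => /andP[v0 va].
  have vh : v - 2^-1 <= 0 by rewrite /a in va; lra.
  by rewrite /tent (ler0_norm vh) max_l ?expr0n//; rewrite /a in va; lra.
have -> : \int[mu]_(v in `[e, 1]) (tent b v ^+ 2) = 0.
  rewrite (@eq_Rintegral _ _ _ mu `[e, 1]%classic (cst 0)) ?Rintegral_cst ?mul0r//.
  move=> v; rewrite inE/= in_itv/= => /andP[v0 va].
  have vh : 0 <= v - 2^-1 by rewrite /e in v0; lra.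
  by rewrite /tent (ger0_norm vh) max_l ?expr0n//; rewrite /e in v0; lra.
have -> : \int[mu]_(v in `[a, 2^-1]) (tent b v ^+ 2) =
          \int[mu]_(v in `[a, 2^-1]) ((v - a) ^+ 2).
  apply: eq_Rintegral => v; rewrite inE/= in_itv/= => /andP[v0 v1].
  have vh : v - 2^-1 <= 0 by lra.
  rewrite /tent (ler0_norm vh) max_r; last by rewrite /a in v0; lra.
  by congr (_ ^+ _); rewrite /a; field.
have -> : \int[mu]_(v in `[2^-1, e]) (tent b v ^+ 2) =
          \int[mu]_(v in `[2^-1, e]) ((v - e) ^+ 2).
  apply: eq_Rintegral => v; rewrite inE/= in_itv/= => /andP[v0 v1].
  have vh : 0 <= v - 2^-1 by lra.
  rewrite /tent (ger0_norm vh) max_r; last by rewrite /e in v1; lra.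
  by rewrite -sqrrN; congr (_ ^+ _); rewrite /e; field.
by rewrite !Rintegral_sqr_shift// /a /e; field.
Qed.

End Outer.

(** * Bounds on xi and beta for arbitrary copulas *)

Section XiBounds.
Context (R : realType).
Local Notation mu := (@lebesgue_measure R).
Local Notation is_density := (is_density R).
Implicit Types C : R -> R -> R.

Lemma mem01 (x : R) : 0 <= x -> x <= 1 -> x \in `[0, 1].
Proof. by rewrite in_itv/= => -> ->. Qed.

Lemma copula_lipschitz_l C v : is_copula C -> v \in `[0, 1] ->
  forall x y, 0 <= x -> x <= y -> y <= 1 -> 0 <= C y v - C x v <= y - x.
Proof.
move=> cC v01 x y x0 xy y1; have /andP[v0 v1] : 0 <= v <= 1 by move: v01; rewrite in_itv.
have x01 : x \in `[0, 1] by apply: mem01; lra.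
have y01 : y \in `[0, 1] by apply: mem01; lra.
have m0 : (0 : R) \in `[0, 1] by apply: mem01; lra.
have m1 : (1 : R) \in `[0, 1] by apply: mem01; lra.
have := copula_2incr cC x01 m0 y01 v01 xy v0.
have := copula_2incr cC x01 v01 y01 m1 xy v1.
rewrite !(copula_0r cC) ?(copula_1r cC)// => h1 h2.
by apply/andP; split; lra.
Qed.

Lemma copula_lipschitz_r C u : is_copula C -> u \in `[0, 1] ->
  forall x y, 0 <= x -> x <= y -> y <= 1 -> 0 <= C u y - C u x <= y - x.
Proof.
move=> cC u01 x y x0 xy y1; have /andP[u0 u1] : 0 <= u <= 1 by move: u01; rewrite in_itv.
have x01 : x \in `[0, 1] by apply: mem01; lra.
have y01 : y \in `[0, 1] by apply: mem01; lra.
have m0 : (0 : R) \in `[0, 1] by apply: mem01; lra.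
have m1 : (1 : R) \in `[0, 1] by apply: mem01; lra.
have := copula_2incr cC m0 x01 u01 y01 u0 xy.
have := copula_2incr cC u01 x01 m1 y01 u1 xy.
rewrite !(copula_0l cC) ?(copula_1l cC)// => h1 h2.
by apply/andP; split; lra.
Qed.

Definition xi_section C (v : R) : R :=
  \int[mu]_(u in `[0, 1]) (derive1 (C ^~ v) u) ^+ 2.

Lemma copula_density C v : is_copula C -> v \in `[0, 1] ->
  exists h, is_density (C ^~ v) h.
Proof.
move=> cC v01; apply: density_exists => /=.
  exact: copula_0l.
exact: copula_lipschitz_l.
Qed.

Lemma xi_section_bounds C v : is_copula C -> v \in `[0, 1] ->
  v ^+ 2 + (2 * C 2^-1 v - v) ^+ 2 <= xi_section C v <= v.
Proof.
move=> cC v01; have [h fh] := copula_density C v cC v01.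
rewrite /xi_section (integral_derive_sqr _ _ _ fh).
have := density_sqr_lower _ _ _ fh; have := density_sqr_upper _ _ _ fh.
by rewrite /= (copula_1l cC v01) => -> ->.
Qed.

Lemma blomqvist_beta_bounds C : is_copula C -> -1 <= blomqvist_beta C <= 1.
Proof.
move=> cC; rewrite /blomqvist_beta.
have h01 : (2^-1 : R) \in `[0, 1] by apply: mem01; lra.
have := copula_lipschitz_l C _ cC h01 0 2^-1; rewrite (copula_0l cC)//.
move=> H; have /andP[] : 0 <= C 2^-1 2^-1 - 0 <= 2^-1 - 0 by apply: H; lra.
by move=> h1 h2; apply/andP; split; lra.
Qed.

(** The function v -> 2 C(1/2, v) - v is 1-Lipschitz, because C(1/2, .) is
nondecreasing and 1-Lipschitz, and takes the value beta/2 at 1/2. *)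
Lemma tent_le_gap C v : is_copula C -> v \in `[0, 1] ->
  tent R `|blomqvist_beta C| v <= `|2 * C 2^-1 v - v|.
Proof.
move=> cC v01; have /andP[v0 v1] : 0 <= v <= 1 by move: v01; rewrite in_itv.
have h01 : (2^-1 : R) \in `[0, 1] by apply: mem01; lra.
have L := copula_lipschitz_r C _ cC h01.
rewrite /tent ge_max normr_ge0/= lerBlDr.
have -> : `|blomqvist_beta C| / 2 = `|2 * C 2^-1 2^-1 - 2^-1|.
  rewrite -[X in _ / X]ger0_norm// -normf_div; congr `|_|.
  by rewrite /blomqvist_beta; field.
apply: le_trans (_ : `|2 * C 2^-1 v - v| +
   `|(2 * C 2^-1 2^-1 - 2^-1) - (2 * C 2^-1 v - v)| <= _).
  rewrite -{1}[2 * C 2^-1 2^-1 - 2^-1](subrKC (2 * C 2^-1 v - v)).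
  exact: ler_normD.
rewrite lerD2l; have [vh|/ltW vh] := leP v 2^-1.
  have /andP[l1 l2] : 0 <= C 2^-1 2^-1 - C 2^-1 v <= 2^-1 - v by apply: L; lra.
  by rewrite [leRHS]ler0_norm ?subr_le0// ler_norml; apply/andP; split; lra.
have /andP[l1 l2] : 0 <= C 2^-1 v - C 2^-1 2^-1 <= v - 2^-1 by apply: L; lra.
by rewrite [leRHS]ger0_norm ?subr_ge0// ler_norml; apply/andP; split; lra.
Qed.

Lemma integral_id_lty : (\int[mu]_(v in `[0%R, 1%R]) v%:E < +oo)%E.
Proof.
rewrite ltey_eq; apply/orP; left.
by apply: integrable_fin_num => //; exact: id_integrable.
Qed.

Lemma chatterjee_xi_le1 C : is_copula C -> chatterjee_xi C <= 1.
Proof.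
move=> cC; rewrite /chatterjee_xi.
have : \int[mu]_(v in `[0, 1]) xi_section C v <= \int[mu]_(v in `[0, 1]) v.
  apply: le_Rintegral_nonmeas => [|v v01|v v01].
  - exact: integral_id_lty.
  - by apply: Rintegral_ge0 => u _; exact: sqr_ge0.
  - by have /andP[] := xi_section_bounds C v cC v01.
rewrite Rintegral_id /xi_section => I1; lra.
Qed.

Lemma chatterjee_xi_lower C : is_copula C ->
  `|blomqvist_beta C| ^+ 3 <= 2 * chatterjee_xi C.
Proof.
move=> cC; rewrite /chatterjee_xi.
set b := `|_|.
have b01 : 0 <= b <= 1 by rewrite normr_ge0/= ler_norml blomqvist_beta_bounds.
have : \int[mu]_(v in `[0, 1]) (v ^+ 2 + tent R b v ^+ 2) <=
    \int[mu]_(v in `[0, 1]) xi_section C v.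
  apply: le_Rintegral_nonmeas => [|v _|v v01].
  - apply: le_lt_trans (_ : \int[mu]_(v in `[0%R, 1%R]) v%:E < +oo)%E; last first.
      exact: integral_id_lty.
    apply: ge0_le_integral_nonmeas => v v01; rewrite lee_fin.
      by apply: Rintegral_ge0 => u _; exact: sqr_ge0.
    by have /andP[] := xi_section_bounds C v cC v01.
  - by rewrite addr_ge0 ?sqr_ge0.
  - have /andP[+ _] := xi_section_bounds C v cC v01; apply: le_trans.
    rewrite lerD2l -[leRHS]real_normK ?num_real//.
    have /andP[t0 _] := tent_bounds R b v b01.
    by rewrite ler_pXn2r ?nnegrE//; exact: tent_le_gap.
rewrite RintegralD//; last 2 first.
- exact: id_sqr_integrable.
- exact: tent_sqr_integrable.
rewrite Rintegral_id_sqr Rintegral_tent_sqr// /xi_section => I1.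
lra.
Qed.

End XiBounds.

(** * A shuffle with xi equal to 1 *)

Section Shuffle.
Context (R : realType).
Implicit Types C : R -> R -> R.

Lemma copula_of_2incr C :
  (forall u, u \in `[0, 1] -> C u 0 = 0) -> (forall v, v \in `[0, 1] -> C 0 v = 0) ->
  (forall u, u \in `[0, 1] -> C u 1 = u) -> (forall v, v \in `[0, 1] -> C 1 v = v) ->
  (forall u1 u2 v1 v2 : R,
    u1 \in `[0, 1] -> u2 \in `[0, 1] -> v1 \in `[0, 1] -> v2 \in `[0, 1] ->
    u1 <= v1 -> u2 <= v2 -> 0 <= C v1 v2 - C u1 v2 - C v1 u2 + C u1 u2) ->
  is_copula C.
Proof.
move=> Cu0 C0v Cu1 C1v C2; split => // u v u01 v01.
have m0 : (0 : R) \in `[0, 1] by apply: mem01; lra.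
have m1 : (1 : R) \in `[0, 1] by apply: mem01; lra.
have /andP[u0 u1] : 0 <= u <= 1 by move: u01; rewrite in_itv.
have /andP[v0 v1] : 0 <= v <= 1 by move: v01; rewrite in_itv.
have := C2 _ _ _ _ m0 m0 u01 v01 u0 v0.
have := C2 _ _ _ _ m0 v01 u01 m1 u0 v1.
rewrite !Cu0 ?C0v ?Cu1// => h1 h2.
by apply: mem01; lra.
Qed.

Lemma min_2incr (a b c d : R) : a <= b -> c <= d ->
  0 <= Num.min b d - Num.min a d - Num.min b c + Num.min a c.
Proof.
by move=> ab cd; case: (leP b d) => ?; case: (leP a d) => ?; case: (leP b c) => ?;
  case: (leP a c) => ?; lra.
Qed.

Lemma pospart_2incr (a b c d : R) : a <= b -> c <= d ->
  0 <= Num.max 0 (b + d - 1) - Num.max 0 (a + d - 1) -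
       Num.max 0 (b + c - 1) + Num.max 0 (a + c - 1).
Proof.
by move=> ab cd; case: (leP 0 (b + d - 1)) => ?; case: (leP 0 (a + d - 1)) => ?;
  case: (leP 0 (b + c - 1)) => ?; case: (leP 0 (a + c - 1)) => ?; lra.
Qed.

(** The copula of (U, T U) for U uniform and T the map that reverses [p, 1 - p]
and fixes the rest of [0, 1]. *)
Definition shuffle (p u v : R) : R :=
  Num.min (Num.min u v) (p + Num.max 0 (u + v - 1)).

(** The three summands are the masses that the graph of T puts on [0, u] x [0, v]
over [0, p], [p, 1 - p] and [1 - p, 1].  Each of them is visibly 2-increasing and
is the primitive of an indicator function in u, whereas radial symmetry is
visible on the closed form. *)
Lemma shuffleE p u v : 0 <= p -> p <= 2^-1 ->
  u \in `[0, 1] -> v \in `[0, 1] ->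
  shuffle p u v =
    Num.min (Num.min u p) (Num.min v p)
    + Num.max 0 (Num.min u (1 - p) + Num.min v (1 - p) - 1)
    + (Num.min (Num.max u (1 - p)) (Num.max v (1 - p)) - (1 - p)).
Proof.
wlog uv : u v / u <= v => [H|].
  have [uv|/ltW vu] := leP u v; first exact: H.
  move=> p0 ph u01 v01; rewrite /shuffle (minC u v) (addrC u v) -/(shuffle p v u) H//.
  congr (_ + Num.max 0 (_ - 1) + (_ - _)); [exact: minC|exact: addrC|exact: minC].
move=> p0 ph; rewrite !in_itv/= => /andP[u0 u1] /andP[v0 v1].
rewrite /shuffle (min_l uv).
have [vq|qv] := leP v (1 - p).
- have uq : u <= 1 - p by lra.
  rewrite (min_l uq) (max_r uq) minxx subrr addr0.
  have [up|pu] := leP u p.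
    rewrite max_l; last by lra.
    rewrite !addr0 (min_l up) min_l//.
    by rewrite le_min uv up.
  rewrite (min_r (ltW (lt_le_trans pu uv))) minxx min_r//.
  by case: (leP 0 (u + v - 1)) => _; lra.
- rewrite (min_r (_ : p <= v)); last by lra.
  have [up|pu] := leP u p.
    have uq : u <= 1 - p by lra.
    rewrite (min_l uq) (max_r uq) (min_l up) (min_l (ltW qv)) subrr addr0.
    rewrite [X in _ = _ + X]max_l; last by lra.
    rewrite addr0 min_l//.
    by case: (leP 0 (u + v - 1)) => _; lra.
  rewrite minxx (max_r (_ : 0 <= u + v - 1)); last by lra.
  rewrite (min_l (_ : u <= p + (u + v - 1))); last by lra.
  have [uq|qu] := leP u (1 - p).
    rewrite (min_l (ltW qv)) subrr addr0 max_r; lra.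
  rewrite (min_l uv) max_r; lra.
Qed.

Lemma shuffle_copula p : 0 <= p -> p <= 2^-1 -> is_copula (shuffle p).
Proof.
move=> p0 ph; apply: copula_of_2incr.
- move=> u; rewrite in_itv/= /shuffle => /andP[u0 u1].
  by rewrite (min_r u0) max_l ?addr0 ?min_l//; lra.
- move=> v; rewrite in_itv/= /shuffle => /andP[v0 v1].
  by rewrite (min_l v0) max_l ?addr0 ?min_l//; lra.
- move=> u; rewrite in_itv/= /shuffle => /andP[u0 u1].
  by rewrite (min_l u1) max_r ?min_l//; lra.
- move=> v; rewrite in_itv/= /shuffle => /andP[v0 v1].
  by rewrite (min_r v1) max_r ?min_l//; lra.
move=> u1 u2 v1 v2 hu1 hu2 hv1 hv2 h1 h2.
rewrite !shuffleE//.
have mn (x y z : R) : x <= y -> Num.min x z <= Num.min y z.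
  by move=> xy; rewrite le_min !ge_min xy lexx orbT.
have mx (x y z : R) : x <= y -> Num.max x z <= Num.max y z.
  by move=> xy; rewrite ge_max !le_max xy lexx orbT.
have := min_2incr _ _ _ _ (mn _ _ p h1) (mn _ _ p h2).
have := pospart_2incr _ _ _ _ (mn _ _ (1 - p) h1) (mn _ _ (1 - p) h2).
have := min_2incr _ _ _ _ (mx _ _ (1 - p) h1) (mx _ _ (1 - p) h2).
lra.
Qed.

Lemma shuffle_rs p : radially_symmetric (shuffle p).
Proof.
move=> u v _ _; rewrite /shuffle.
rewrite (_ : 1 - u + (1 - v) - 1 = 1 - u - v); last by ring.
case: (leP u v) => uv; case: (leP (1 - u) (1 - v)) => uv'; try lra;
case: (leP 0 (u + v - 1)) => w; case: (leP 0 (1 - u - v)) => w'; try lra;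
  rewrite ?addr0 ?minEle; do ! (case: ifPn; rewrite -?ltNge => ?); lra.
Qed.

Lemma shuffle_center p : p <= 2^-1 -> shuffle p 2^-1 2^-1 = p.
Proof.
move=> ph; rewrite /shuffle minxx max_l; last by lra.
by rewrite addr0 min_r.
Qed.

(** The indicator function of the set of u with T(u) <= v, up to a null set. *)
Definition shuffle_slope (p v u : R) : R :=
  \1_(`]0, Num.min v p]%classic : set R) u
  + \1_(`]1 - Num.min v (1 - p), 1 - p]%classic : set R) u
  + \1_(`]1 - p, v]%classic : set R) u.

Lemma shuffle_slope01 p v u : 0 <= p -> p <= 2^-1 -> v \in `[0, 1] ->
  shuffle_slope p v u = 0 \/ shuffle_slope p v u = 1.
Proof.
move=> p0 ph; rewrite in_itv/= => /andP[v0 v1].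
have n1 : Num.min v (1 - p) <= 1 - p by rewrite ge_min lexx orbT.
have n2 : Num.min v p <= p by rewrite ge_min lexx orbT.
rewrite /shuffle_slope !indicE !mem_setE !in_itv/=.
have [u0|u0] := ltP 0 u; have [un|un] := leP u (Num.min v p);
have [uq|uq] := ltP (1 - Num.min v (1 - p)) u; have [uq'|uq'] := leP u (1 - p);
have [uv|uv] := leP u v; rewrite /= ?addr0 ?add0r; try (by left); try (by right); lra.
Qed.

End Shuffle.

(** * Densities of the two extremal copulas *)

Section Family.
Context (R : realType).
Local Notation mu := (@lebesgue_measure R).
Local Notation is_density := (is_density R).
Local Notation shuffle := (shuffle R).
Local Notation shuffle_slope := (shuffle_slope R).
Local Notation tent := (tent R).
Local Notation half := (\1_(`]0, 2^-1]%classic : set R)).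
Implicit Types C : R -> R -> R.

Lemma indic_integrable (b c x : R) :
  mu.-integrable `[0, x] (EFin \o (\1_(`]b, c]%classic : set R) : R -> R)).
Proof.
apply: (@bounded_integrable R _ 1); first exact: measurable_indic.
by move=> u _; have /andP[i0 i1] := indic01 R `]b, c]%classic u; rewrite ger0_norm.
Qed.

Lemma shuffle_density p v : 0 <= p -> p <= 2^-1 -> v \in `[0, 1] ->
  is_density ((shuffle p) ^~ v) (shuffle_slope p v).
Proof.
move=> p0 ph v01; have /andP[v0 v1] : 0 <= v <= 1 by move: v01; rewrite in_itv.
split.
- by apply: measurable_funD; [apply: measurable_funD|]; exact: measurable_indic.
- by move=> u; case: (shuffle_slope01 R p v u p0 ph v01) => ->; rewrite lexx ler01.
move=> x x01; rewrite shuffleE//; move: x01; rewrite in_itv/= => /andP[x0 x1].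
rewrite /shuffle_slope RintegralD//; last 2 first.
- exact: (integrableD _ (indic_integrable _ _ _) (indic_integrable _ _ _)).
- exact: indic_integrable.
rewrite RintegralD ?Rintegral_indic_itvoc//; try exact: indic_integrable; last 2 first.
- by lra.
- by rewrite subr_ge0 ge_min v1.
congr (_ + _ + _).
- rewrite subr0 max_r; first by rewrite minACA minxx minA.
  by rewrite !le_min x0 v0 p0.
- by congr Num.max; ring.
- by rewrite -max_minl addr_maxl subrr maxC.
Qed.

(** e is the sign of beta and b its absolute value. *)
Definition tent_copula (e b u v : R) : R :=
  u * v + e * tent b v * Num.min u (1 - u).

Lemma tent_le b v : 0 <= b <= 1 -> v \in `[0, 1] -> tent b v <= v /\ tent b v <= 1 - v.
Proof.
move=> b01; rewrite in_itv/= => /andP[v0 v1]; rewrite /tent !ge_max subr_ge0 v0 v1/=.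
by have [h|h] := leP 0 (v - 2^-1); [rewrite ger0_norm|rewrite ltr0_norm]; lra.
Qed.

Lemma tent_lipschitz b x y : x <= y -> `|tent b y - tent b x| <= y - x.
Proof.
move=> xy; rewrite /tent ler_norml.
have [h|h] := leP 0 (x - 2^-1); have [h'|h'] := leP 0 (y - 2^-1);
rewrite ?(ger0_norm h) ?(ger0_norm h') ?(ltr0_norm h) ?(ltr0_norm h');
rewrite ?maxEle; do ! (case: ifPn; rewrite -?ltNge => ?); apply/andP; split; lra.
Qed.

(** Both tent and min(u, 1 - u) are 1-Lipschitz, so the perturbation of uv
changes the mass of a rectangle by at most its area. *)
Lemma tent_is_copula e b : `|e| = 1 -> 0 <= b <= 1 -> is_copula (tent_copula e b).
Proof.
move=> e1 b01; have /andP[b0 b1] := b01.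
have [t00 t01] := tent_le b 0 b01 (mem01 R 0 (lexx 0) ler01).
have [t10 t11] := tent_le b 1 b01 (mem01 R 1 ler01 (lexx 1)).
have t0 v : 0 <= tent b v by have /andP[] := tent_bounds R b v b01.
have T0 : tent b 0 = 0 by apply/eqP; rewrite eq_le t00 t0.
have T1 : tent b 1 = 0 by apply/eqP; rewrite eq_le t0 andbT; lra.
apply: copula_of_2incr; rewrite /tent_copula.
- by move=> u _; rewrite T0; ring.
- by move=> v _; rewrite subr0 min_l//; ring.
- by move=> u _; rewrite T1; ring.
- by move=> v _; rewrite subrr min_r//; ring.
move=> u1 u2 v1 v2 _ _ _ _ h1 h2.
have hm : `|Num.min v1 (1 - v1) - Num.min u1 (1 - u1)| <= v1 - u1.
  rewrite ler_norml ?minEle.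
  by do ! (case: ifPn; rewrite -?ltNge => ?); apply/andP; split; lra.
have ht := tent_lipschitz b u2 v2 h2.
set m := Num.min v1 _ - _ in hm; set t := tent b v2 - _ in ht.
rewrite [leRHS](_ : _ = (v1 - u1) * (v2 - u2) + e * t * m); last by rewrite /m /t; ring.
have : `|e * t * m| <= (v1 - u1) * (v2 - u2).
  by rewrite !normrM e1 mul1r mulrC ler_pM.
by rewrite ler_norml => /andP[]; lra.
Qed.

Lemma tent_copula_rs e b : radially_symmetric (tent_copula e b).
Proof.
move=> u v _ _; rewrite /tent_copula.
have -> : tent b (1 - v) = tent b v.
  rewrite /tent (_ : 1 - v - 2^-1 = - (v - 2^-1)) ?normrN//; by field.
by rewrite (_ : 1 - (1 - u) = u) ?(minC (1 - u)); ring.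
Qed.

Lemma tent_copula_density e b v : `|e| = 1 -> 0 <= b <= 1 -> v \in `[0, 1] ->
  is_density ((tent_copula e b) ^~ v)
    (fun u => v - e * tent b v + 2 * (e * tent b v) * half u).
Proof.
move=> e1 b01 v01; set d := e * tent b v.
have [tv tv'] := tent_le b v b01 v01.
have t0 : 0 <= tent b v by have /andP[] := tent_bounds R b v b01.
have dt : `|d| = tent b v by rewrite /d normrM e1 mul1r ger0_norm.
have /andP[d1 d2] : - tent b v <= d <= tent b v by rewrite -ler_norml dt.
split.
- apply: measurable_funD; first exact: measurable_cst.
  by apply: measurable_funM; [exact: measurable_cst|exact: measurable_indic].
- by move=> u; rewrite indicE; case: (_ \in _); rewrite /= ?mulr1 ?mulr0; lra.
move=> x; rewrite in_itv/= => /andP[x0 x1].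
have ic : mu.-integrable `[0, x] (EFin \o (fun u : R => (v - d) * cst 1 u)).
  exact: (integrableZl _ _ (density_integrable R _ _ 0 x (cst1_density R))).
have ih : mu.-integrable `[0, x] (EFin \o (fun u : R => 2 * d * half u)).
  exact: (integrableZl _ _ (indic_integrable 0 2^-1 x)).
transitivity (\int[mu]_(u in `[0, x]) ((v - d) * cst 1 u + 2 * d * half u)); last first.
  by apply: eq_Rintegral => u _; rewrite /= mulr1.
rewrite RintegralD//.
have i1 := density_integrable R _ _ 0 x (cst1_density R).
rewrite (RintegralZl (v - d) _ i1)//.
rewrite (RintegralZl (2 * d) _ (indic_integrable 0 2^-1 x))//.
have [_ _ /(_ x) <-] := cst1_density R; last by apply: mem01.
rewrite Rintegral_indic_itvoc// subr0 max_r; last by rewrite le_min x0/=; lra.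
rewrite /tent_copula -/d.
case: (leP x 2^-1) => hx.
  by rewrite min_l; [ring|lra].
by rewrite min_r; [field|lra].
Qed.

End Family.

(** * The segment between the extremal copulas *)

Section Mixture.
Context (R : realType).
Local Notation mu := (@lebesgue_measure R).
Local Notation is_density := (is_density R).
Local Notation shuffle := (shuffle R).
Local Notation shuffle_slope := (shuffle_slope R).
Local Notation tent := (tent R).
Local Notation tent_copula := (tent_copula R).
Local Notation half := (\1_(`]0, 2^-1]%classic : set R)).
Implicit Types C D : R -> R -> R.

Definition mixture (t : R) C D (u v : R) : R := (1 - t) * C u v + t * D u v.

Lemma mixture_copula t C D : 0 <= t <= 1 -> is_copula C -> is_copula D ->
  is_copula (mixture t C D).
Proof.
move=> /andP[t0 t1] cC cD; apply: copula_of_2incr; rewrite /mixture.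
- by move=> u u01; rewrite (copula_0r cC)// (copula_0r cD)//; ring.
- by move=> v v01; rewrite (copula_0l cC)// (copula_0l cD)//; ring.
- by move=> u u01; rewrite (copula_1r cC)// (copula_1r cD)//; ring.
- by move=> v v01; rewrite (copula_1l cC)// (copula_1l cD)//; ring.
move=> u1 u2 v1 v2 hu1 hu2 hv1 hv2 h1 h2.
have c2 := copula_2incr cC hu1 hu2 hv1 hv2 h1 h2.
have d2 := copula_2incr cD hu1 hu2 hv1 hv2 h1 h2.
rewrite [leRHS](_ : _ = (1 - t) * (C v1 v2 - C u1 v2 - C v1 u2 + C u1 u2) +
  t * (D v1 v2 - D u1 v2 - D v1 u2 + D u1 u2)); last by ring.
by rewrite addr_ge0// mulr_ge0// subr_ge0.
Qed.

Lemma mixture_rs t C D : radially_symmetric C -> radially_symmetric D ->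
  radially_symmetric (mixture t C D).
Proof.
by move=> rC rD u v u01 v01; rewrite /mixture rC// rD//; ring.
Qed.

Lemma mixture_density t (f g h k : R -> R) : 0 <= t <= 1 ->
  is_density f h -> is_density g k ->
  is_density (fun x => (1 - t) * f x + t * g x) (fun u => (1 - t) * h u + t * k u).
Proof.
move=> /andP[t0 t1] fh gk; have [mh h01 fE] := fh; have [mk k01 gE] := gk; split.
- apply: measurable_funD; apply: measurable_funM => //.
- move=> u; have /andP[h0 h1] := h01 u; have /andP[k0 k1] := k01 u.
  by apply/andP; split; nra.
move=> x x01; rewrite fE// gE//.
have ih := density_integrable R f h 0 x fh; have ik := density_integrable R g k 0 x gk.
rewrite RintegralD//; last 2 first.
- exact: (integrableZl _ _ ih).
- exact: (integrableZl _ _ ik).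
by rewrite (RintegralZl (1 - t) _ ih)// (RintegralZl t _ ik).
Qed.

(** The density of the tent copula is a step function jumping at 1/2, so the two
square terms and the cross term are given by [Rintegral_step_density]; the
density of the shuffle takes values 0 and 1 and equals its own square. *)
Lemma xi_section_mixture t e b p v :
  0 <= t <= 1 -> `|e| = 1 -> 0 <= b <= 1 -> 0 <= p -> p <= 2^-1 -> v \in `[0, 1] ->
  xi_section R (mixture t (tent_copula e b) (shuffle p)) v =
    (1 - t) ^+ 2 * (v ^+ 2 + tent b v ^+ 2) +
    2 * t * (1 - t) * (v ^+ 2 + e * tent b v * (2 * shuffle p 2^-1 v - v)) +
    t ^+ 2 * v.
Proof.
move=> t01 e1 b01 p0 ph v01.
have dT := tent_copula_density R e b v e1 b01 v01.
have dS := shuffle_density R p v p0 ph v01.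
rewrite /xi_section (integral_derive_sqr _ _ _ (mixture_density t _ _ _ _ t01 dT dS)).
have cT := tent_is_copula R e b e1 b01; have cS := shuffle_copula R p p0 ph.
set d := e * tent b v.
have d2 : d ^+ 2 = tent b v ^+ 2.
  by rewrite -real_normK ?num_real// /d normrM e1 mul1r real_normK ?num_real.
set s := fun u => v - d + 2 * d * half u in dT *.
pose h := shuffle_slope p v.
have hh u : h u ^+ 2 = h u.
  by rewrite /h; case: (shuffle_slope01 R p v u p0 ph v01) => ->; rewrite ?expr0n ?expr1n.
have iss : mu.-integrable `[0, 1] (EFin \o (fun u => s u * s u)).
  exact: (step_density_integrable R _ _ (v - d) (2 * d) _ dT).
have ish : mu.-integrable `[0, 1] (EFin \o (fun u => s u * h u)).
  exact: (step_density_integrable R _ _ (v - d) (2 * d) _ dS).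
have ih := density_integrable R _ _ 0 1 dS.
transitivity (\int[mu]_(u in `[0, 1])
   ((1 - t) ^+ 2 * (s u * s u) + 2 * t * (1 - t) * (s u * h u) + t ^+ 2 * h u)).
  by apply: eq_Rintegral => u _; rewrite -[X in _ = _ + _ * X]hh -/h -/(s u); ring.
have i1 := integrableZl _ ((1 - t) ^+ 2) iss.
have i2 := integrableZl _ (2 * t * (1 - t)) ish.
have i3 := integrableZl _ (t ^+ 2) ih.
rewrite RintegralD//; last 2 first.
- exact: (integrableD _ (i1 _) (i2 _)).
- exact: i3.
rewrite RintegralD//; last 2 first.
- exact: i1.
- exact: i2.
rewrite (RintegralZl _ _ iss)// (RintegralZl _ _ ish)// (RintegralZl _ _ ih)//.
have -> : \int[mu]_(u in `[0, 1]) h u = shuffle p 1 v.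
  by have [_ _ /(_ 1) ->//] := dS; rewrite in_itv/= ler01 lexx.
rewrite (Rintegral_step_density R _ _ (v - d) (2 * d) dT).
rewrite (Rintegral_step_density R _ _ (v - d) (2 * d) dS).
rewrite (copula_1l cT)// (copula_1l cS)//.
have -> : tent_copula e b 2^-1 v = (v + d) / 2.
  by rewrite /tent_copula -/d (_ : 1 - 2^-1 = 2^-1 :> R) ?minxx; field.
rewrite -d2.
by field.
Qed.

Lemma cross_term_integrable e b p :
  `|e| = 1 -> 0 <= b <= 1 -> 0 <= p -> p <= 2^-1 ->
  mu.-integrable `[0, 1]
    (EFin \o (fun v => v ^+ 2 + e * tent b v * (2 * shuffle p 2^-1 v - v))).
Proof.
move=> e1 b01 p0 ph; apply: (@bounded_integrable R _ 4).
  apply: measurable_funD; first exact: measurable_funX.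
  apply: measurable_funM.
    by apply: measurable_funM => //; exact: measurable_tent.
  apply: measurable_funB => //; apply: measurable_funM => //.
  apply: measurable_minr; first exact: measurable_minr.
  apply: measurable_funD => //; apply: measurable_maxr => //.
  by apply: measurable_funB => //; exact: measurable_funD.
move=> v v01; have /andP[v0 v1] : 0 <= v <= 1 by move: v01; rewrite in_itv.
have cS := shuffle_copula R p p0 ph.
have := copula_range cS (mem01 R 2^-1 _ _) v01; rewrite in_itv/= => H.
have /andP[s0 s1] : 0 <= shuffle p 2^-1 v <= 1 by apply: H; lra.
have /andP[t0 t1] := tent_bounds R b v b01.
apply: le_trans (ler_normD _ _) _; rewrite ger0_norm ?sqr_ge0// !normrM e1 mul1r.
rewrite (ger0_norm t0).
have : `|2 * shuffle p 2^-1 v - v| <= 3 by rewrite ler_norml; apply/andP; split; lra.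
have := normr_ge0 (2 * shuffle p 2^-1 v - v).
move: (`|_|) => w w0 w3.
nra.
Qed.

Lemma chatterjee_xi_mixture e b p :
  `|e| = 1 -> 0 <= b <= 1 -> 0 <= p -> p <= 2^-1 ->
  exists K : R, forall t, 0 <= t <= 1 ->
  chatterjee_xi (mixture t (tent_copula e b) (shuffle p)) =
    6 * ((1 - t) ^+ 2 * (3^-1 + b ^+ 3 / 12) + 2 * t * (1 - t) * K + t ^+ 2 * 2^-1) - 2.
Proof.
move=> e1 b01 p0 ph.
have iK := cross_term_integrable e b p e1 b01 p0 ph.
pose k v := v ^+ 2 + e * tent b v * (2 * shuffle p 2^-1 v - v).
rewrite -/k in iK.
exists (\int[mu]_(v in `[0, 1]) k v) => t t01.
rewrite /chatterjee_xi; congr (6 * _ - 2).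
rewrite (@eq_Rintegral _ _ _ mu `[0, 1]%classic
  (fun v => (1 - t) ^+ 2 * (v ^+ 2 + tent b v ^+ 2) + 2 * t * (1 - t) * k v +
            t ^+ 2 * v)); last first.
  move=> v; rewrite inE/= => v01.
  exact: (xi_section_mixture t e b p v t01 e1 b01 p0 ph v01).
have i0 : mu.-integrable `[0, 1] (EFin \o (fun v => v ^+ 2 + tent b v ^+ 2)).
  exact: (integrableD _ (id_sqr_integrable R) (tent_sqr_integrable R b b01)).
have i1 := integrableZl _ ((1 - t) ^+ 2) i0.
have i2 := integrableZl _ (2 * t * (1 - t)) iK.
have i3 := integrableZl _ (t ^+ 2) (id_integrable R).
rewrite RintegralD//; last 2 first.
- exact: (integrableD _ (i1 _) (i2 _)).
- exact: i3.
rewrite RintegralD//; last 2 first.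
- exact: i1.
- exact: i2.
rewrite (RintegralZl _ _ i0)// (RintegralZl _ _ iK)//.
rewrite (RintegralZl _ _ (id_integrable R))//.
rewrite Rintegral_id RintegralD//; last 2 first.
- exact: id_sqr_integrable.
- exact: tent_sqr_integrable.
by rewrite Rintegral_id_sqr Rintegral_tent_sqr.
Qed.

(** Whatever the cross term K, xi is a polynomial in t with values b^3/2 and 1 at
the ends of [0, 1]. *)
Lemma exists_rs_copula_xi_beta (x y : R) :
  x \in `[0, 1] -> y \in `[-1, 1] -> `|y| ^+ 3 <= 2 * x ->
  exists C, [/\ is_copula C, radially_symmetric C,
    chatterjee_xi C = x & blomqvist_beta C = y].
Proof.
rewrite !in_itv/= => /andP[x0 x1] /andP[y0 y1] xy.
pose b := `|y|.
have b01 : 0 <= b <= 1 by rewrite normr_ge0/= ler_norml y0 y1.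
have [e e1 ey] : exists2 e : R, `|e| = 1 & e * b = y.
  have [h|h] := leP 0 y.
    by exists 1; rewrite ?normr1// mul1r /b ger0_norm.
  by exists (-1); rewrite ?normrN1// /b ltr0_norm//; ring.
pose p := (1 + y) / 4.
have p0 : 0 <= p by rewrite /p; lra.
have ph : p <= 2^-1 by rewrite /p; lra.
have [K xiE] := chatterjee_xi_mixture e b p e1 b01 p0 ph.
have [q qE] : exists q : {poly R}, forall t, q.[t] =
    6 * ((1 - t) ^+ 2 * (3^-1 + b ^+ 3 / 12)
      + 2 * t * (1 - t) * K + t ^+ 2 * 2^-1) - 2.
  exists (6 *: ((3^-1 + b ^+ 3 / 12) *: (1 - 'X) ^+ 2
    + (2 * K) *: ('X * (1 - 'X)) + 2^-1 *: 'X ^+ 2) - 2%:P) => t.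
  by rewrite !hornerE /=; ring.
have [|t t01 /rootP] := @poly_ivt R (q - x%:P) 0 1 ler01.
  rewrite !hornerD !hornerN !hornerC !qE; apply/andP; split; last by lra.
  by move: xy; rewrite -/b; lra.
rewrite hornerD hornerN hornerC => /eqP; rewrite subr_eq0 => /eqP qt.
exists (mixture t (tent_copula e b) (shuffle p)).
split.
- apply: mixture_copula => //; [exact: tent_is_copula|exact: shuffle_copula].
- apply: mixture_rs; [exact: tent_copula_rs|exact: shuffle_rs].
- by rewrite xiE// -qE.
- rewrite /blomqvist_beta /mixture shuffle_center// /tent_copula.
  rewrite (_ : tent b 2^-1 = b / 2); last first.
    rewrite /tent subrr normr0 subr0 max_r//; case/andP: b01; lra.
  rewrite (_ : 1 - 2^-1 = 2^-1) ?minxx; last by field.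
  by rewrite mulrA ey /p; field.
Qed.

End Mixture.

Theorem corollary7 (R : realType) :
  [set (chatterjee_xi C, blomqvist_beta C) | C in rs_copulas R] =
    [set (chatterjee_xi C, blomqvist_beta C) | C in copulas R] /\
  [set (chatterjee_xi C, blomqvist_beta C) | C in copulas R] =
    [set p : R * R | p.1 \in `[0, 1] /\ p.2 \in `[-1, 1] /\
                     `|p.2| ^+ 3 <= 2 * p.1].
Proof.
set A := [set _ | _ in rs_copulas R]; set B := [set _ | _ in copulas R].
set S := [set p | _].
have AB : A `<=` B by move=> _ [C [cC _] <-]; exists C.
have BS : B `<=` S.
  move=> _ [C /= cC <-]; rewrite /S/=.
  have xib := chatterjee_xi_lower R C cC.
  split; last by split => //; rewrite in_itv/= blomqvist_beta_bounds.
  rewrite in_itv/= chatterjee_xi_le1// andbT.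
  by rewrite -(pmulr_rge0 _ (ltr0n R 2)) (le_trans _ xib)// exprn_ge0.
have SA : S `<=` A.
  move=> [x y] /= [x01 [y01 xy]].
  by have [C [cC rC <- <-]] := exists_rs_copula_xi_beta R x y x01 y01 xy; exists C.
have AS : A = S by apply/seteqP; split => // z /AB /BS.
have BS' : B = S by apply/seteqP; split => // z /SA /AB.
by rewrite AS BS'.
Qed.
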